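(* Let $v_1,v_2$ be nonzero non-negative integers such that $\mathcal{U}=U_{\mathcal A}(v_1,v_2)$ is non-degenerate. Then, replacing if necessary $\mathcal U$ by its reflection $\{(y,x):(x,y)\in\mathcal U\}=U_{\mathcal A}(v_2,v_1)$ and $(v_1,v_2)$ by $(v_2,v_1)$, exactly one of the following holds: (1) $v_1,v_2\in2\mathbb{Z}\cap[4,\infty)$ and $\mathcal U$ is of $L$ type for $(v_1,v_2)$; (2) $v_1\in2\mathbb{Z}$, $v_2\in(1+2\mathbb{Z})\cap[4,\infty)$, and $\mathcal U$ is of column-deleted type for $(v_1,v_2)$; (3) $v_1\in2\mathbb{Z}\cap[4,\infty)$, $v_2=2$, and $\mathcal U$ is of column-deleted $L$ type for $(v_1,v_2)$; (4) $v_1\in2\mathbb{Z}$, $v_2=3$, and $\mathcal U$ is of shifted column-deleted type for $(v_1,v_2)$; (5) $v_1=v_2=2$ and $\mathcal U$ is of exceptional type.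
   Context: Fix a norm on $\mathbb{Z}^2$ increasing monotonically in each coordinate. For vectors $w_1,\dots,w_k\in\mathbb{Z}_{\ge0}^2$, the Ulam set $U(w_1,\dots,w_k)$ is built recursively: it starts with $w_1,\dots,w_k$, and at each step one adds a vector not yet in the set, of smallest norm among those that can be written as a sum of two distinct vectors of the current set in exactly one way (the resulting set is known not to depend on the choice of such norm or on tie-breaking). $U(w_1,\dots,w_k)$ is non-degenerate if $w_i\notin U(w_1,\dots,w_{i-1},w_{i+1},\dots,w_k)$ for each $i$. Let $\mathcal A=U((1,0),(0,1))$ and $U_{\mathcal A}(v_1,v_2)=U((1,0),(0,1),(v_1,v_2))$. Let $W_{(v_1,v_2)}=\{(m,n)\in\mathbb{Z}_{\ge0}^2: m<v_1\text{ or }n<v_2\}$ and $R=\{(m,1):m\in\mathbb{Z}_{\ge0}\}\cup\{(1,m):m\in\mathbb{Z}_{\ge0}\}$. For $U\subset\mathbb{Z}^2_{\ge0}$ and $(v_1,v_2)\in U$: $U$ is of $L$ type for $(v_1,v_2)$ if $U=\{(v_1,v_2)\}\cup R\cup\{(a+2mv_1,b+2mv_2): a,b,m\in\mathbb{Z}_{\ge0},\ a,b\text{ odd},\ (a,b)\in W_{(v_1,v_2)}\}$. $U$ is of column-deleted type for $(v_1,v_2)$ if $U=\{(v_1,v_2)\}\cup R\cup\{(2m+1,2n+1): m,n\in\mathbb{Z}_{\ge0},\ \text{if }2m+1=v_1+1\text{ then }2n+1<v_2\}$. $U$ is of column-deleted $L$ type for $(v_1,v_2)$ if $U=\{(v_1,v_2)\}\cup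 R\cup\{(a+(m+1)v_2+2,\ b+2m+5): a,b,m\in2\mathbb{Z}_{\ge0},\ a<m\text{ or }b=0\}$. $U$ is of shifted column-deleted type for $(v_1,v_2)$ if $U=\{(v_1,v_2)\}\cup R\cup\{(m,n): m,n\ge0,\ m<v_1,\ m,n\text{ odd}\}\cup\{(m,n): m,n\ge0,\ m>v_1,\ m\text{ even},\ n\text{ odd}\}$. $U$ is of exceptional type if $U=\{(v_1,v_2)\}\cup\{(8,8)\}\cup R\cup\{(4,2m+4):m\in\mathbb{Z}_{\ge0}\}\cup\{(2m+4,4):m\in\mathbb{Z}_{\ge0}\}$.
   Formalization: The printed column-deleted L type is false ((3,3) lies in U_A(4,2)); it is corrected to {(v1,v2)} ∪ R ∪ {(m,n): m<v1, m,n odd} ∪ {(a+(m+1)v1+2, b+2m+5): a,b,m even, a<v1 or b=0}. The norm is taken strictly increasing on the quadrant. *)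

(* Defs.v *)
From mathcomp Require Import all_boot all_order all_algebra.
From mathcomp Require Import classical_sets reals.
Set Implicit Arguments.
Unset Strict Implicit.
Unset Printing Implicit Defensive.
Import Order.TTheory GRing.Theory Num.Theory.
Local Open Scope classical_set_scope.
Local Open Scope ring_scope.

Record is_norm (R : realType) (N : int * int -> R) : Prop := IsNorm {
  norm_ge0 : forall z, 0 <= N z;
  norm_eq0 : forall z, N z = 0 <-> z = 0;
  norm_homogeneous : forall (k : int) z, N (z *~ k) = `|k|%:~R * N z;
  norm_triangle : forall z w, N (z + w) <= N z + N w
}.

(* A norm is even, so it can only be increasing on the quadrant.  The
   monotonicity is strict: for the sup norm the construction below depends on
   how ties are broken. *)
Definition increasing_in_each_coordinate (R : realType) (N : int * int -> R)
    : Prop :=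
  (forall x x' y : nat, (x < x')%N -> N (x%:Z, y%:Z) < N (x'%:Z, y%:Z)) /\
  (forall x y y' : nat, (y < y')%N -> N (x%:Z, y%:Z) < N (x%:Z, y'%:Z)).

(* Exactly one way means one unordered pair of distinct summands. *)
Definition uniquely_represented (S : set (nat * nat)) (w : nat * nat) : Prop :=
  exists x y : nat * nat,
    [/\ S x, S y, x <> y & x + y = w] /\
    (forall x' y' : nat * nat, S x' -> S y' -> x' <> y' -> x' + y' = w ->
       (x' = x /\ y' = y) \/ (x' = y /\ y' = x)).

Definition ulam_candidate (S : set (nat * nat)) (w : nat * nat) : Prop :=
  ~ S w /\ uniquely_represented S w.

(* Ties are left open.  The second disjunct only makes the stages an infinite
   sequence when the construction stops. *)
Definition ulam_step (R : realType) (N : int * int -> R)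
    (S S' : set (nat * nat)) : Prop :=
  (exists w : nat * nat,
     [/\ ulam_candidate S w,
         (forall w', ulam_candidate S w' ->
            N (w.1%:Z, w.2%:Z) <= N (w'.1%:Z, w'.2%:Z))
       & S' = S `|` [set w]]) \/
  ((forall w, ~ ulam_candidate S w) /\ S' = S).

(* [is_ulam_set N ws U]: some run of the construction from ws yields U. *)
Definition is_ulam_set (R : realType) (N : int * int -> R)
    (ws : seq (nat * nat)) (U : set (nat * nat)) : Prop :=
  exists stage : nat -> set (nat * nat),
    [/\ stage 0%N = [set w | w \in ws],
        (forall n, ulam_step N (stage n) (stage n.+1))
      & U = \bigcup_n stage n].

Definition ulam_nondegenerate (R : realType) (N : int * int -> R)
    (ws : seq (nat * nat)) : Prop :=
  forall i, (i < size ws)%N ->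
  forall U, is_ulam_set N (take i ws ++ drop i.+1 ws) U ->
  ~ U (nth (0, 0)%N ws i).

Definition UA_generators (v1 v2 : nat) : seq (nat * nat) :=
  [:: (1, 0); (0, 1); (v1, v2)]%N.

Definition reflection (U : set (nat * nat)) : set (nat * nat) :=
  [set z | U (z.2, z.1)].

Local Open Scope nat_scope.

Definition Wset (v1 v2 : nat) : set (nat * nat) :=
  [set z | z.1 < v1 \/ z.2 < v2].

Definition Rset : set (nat * nat) :=
  [set z | exists m, z = (m, 1)] `|` [set z | exists m, z = (1, m)].

Definition L_type (U : set (nat * nat)) (v1 v2 : nat) : Prop :=
  U = [set (v1, v2)] `|` Rset `|`
      [set z | exists a b m : nat, [/\ odd a, odd b, Wset v1 v2 (a, b)
                 & z = (a + 2 * m * v1, b + 2 * m * v2)]].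

Definition column_deleted_type (U : set (nat * nat)) (v1 v2 : nat) : Prop :=
  U = [set (v1, v2)] `|` Rset `|`
      [set z | exists m n : nat,
                 (2 * m + 1 = v1 + 1 -> 2 * n + 1 < v2) /\
                 z = (2 * m + 1, 2 * n + 1)].

(* The source prints
     {(v1,v2)} u Rset u {(a+(m+1)v2+2, b+2m+5) : a, b, m even, a < m or b = 0},
   which is not the Ulam set of any (v1, 2) with v1 >= 4 even: its points
   outside Rset and (v1,v2) have even abscissa, whereas (3,3) = (2,1) + (1,2) lies
   in U_A(v1,2).  Here v2 and the bound a < m are corrected to v1 and a < v1,
   and the odd columns to the left of v1 are restored. *)
Definition column_deleted_L_type (U : set (nat * nat)) (v1 v2 : nat) : Prop :=
  U = [set (v1, v2)] `|` Rset `|`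
      [set z | [/\ z.1 < v1, odd z.1 & odd z.2]] `|`
      [set z | exists a b m : nat,
                 [/\ ~~ odd a, ~~ odd b, ~~ odd m, a < v1 \/ b = 0
                   & z = (a + (m + 1) * v1 + 2, b + 2 * m + 5)]].

Definition shifted_column_deleted_type (U : set (nat * nat)) (v1 v2 : nat)
    : Prop :=
  U = [set (v1, v2)] `|` Rset `|`
      [set z | [/\ z.1 < v1, odd z.1 & odd z.2]] `|`
      [set z | [/\ v1 < z.1, ~~ odd z.1 & odd z.2]].

Definition exceptional_type (U : set (nat * nat)) (v1 v2 : nat) : Prop :=
  U = [set (v1, v2)] `|` [set (8, 8)] `|` Rset `|`
      [set z | exists m, z = (4, 2 * m + 4)] `|`
      [set z | exists m, z = (2 * m + 4, 4)].

Inductive ulam_case : Set :=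
  | CaseL
  | CaseColumnDeleted
  | CaseColumnDeletedL
  | CaseShiftedColumnDeleted
  | CaseExceptional.

Definition case_holds (U : set (nat * nat)) (v1 v2 : nat) (c : ulam_case)
    : Prop :=
  match c with
  | CaseL =>
      (~~ odd v1 /\ 4 <= v1) /\ (~~ odd v2 /\ 4 <= v2) /\ L_type U v1 v2
  | CaseColumnDeleted =>
      ~~ odd v1 /\ (odd v2 /\ 4 <= v2) /\ column_deleted_type U v1 v2
  | CaseColumnDeletedL =>
      (~~ odd v1 /\ 4 <= v1) /\ v2 = 2 /\ column_deleted_L_type U v1 v2
  | CaseShiftedColumnDeleted =>
      ~~ odd v1 /\ v2 = 3 /\ shifted_column_deleted_type U v1 v2
  | CaseExceptional =>
      (v1 = 2 /\ v2 = 2) /\ exceptional_type U v1 v2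
  end.

(* Main.v *)
(* Whatever the norm and the ties, an Ulam set U with generators ws is the only
   solution of "U w iff w is in ws or w is uniquely represented by U": a run
   adds points by nondecreasing norm, summands are strictly smaller than their
   sum, and only finitely many points lie below a given norm.  This makes the
   reflection immediate, and each case reduces to checking that an explicit set
   solves the equation.  Such a set is the two lines x = 1 and y = 1 together
   with interior points x, y >= 2.  A point (x, y) with x, y >= 3 always has the
   representation (x-1, 1) + (1, y-1), so it belongs to U iff row y-1 has no
   interior point at abscissa <= x, column x-1 has none at ordinate <= y, and
   (x, y) is not the sum of two distinct interior points. *)
Require Import Defs.
From mathcomp Require Import all_boot all_order all_algebra.
From mathcomp Require Import boolp classical_sets reals.
From mathcomp Require Import zify.
Set Implicit Arguments.
Unset Strict Implicit.
Unset Printing Implicit Defensive.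
Import Order.TTheory GRing.Theory Num.Theory.
Local Open Scope classical_set_scope.
Local Open Scope nat_scope.

(** * The fixpoint equation and the uniqueness of its solution *)

Definition ulam_fixpoint (ws : seq (nat * nat)) (U : set (nat * nat)) : Prop :=
  forall w, U w <-> w \in ws \/ uniquely_represented U w.

Lemma add_pairE (a b c d : nat) : ((a, b) + (c, d))%R = (a + c, b + d).
Proof. by []. Qed.

(** Splitting pairs into coordinates turns distinctness and sum conditions into linear arithmetic
    for [lia]. *)
Lemma uniquely_representedP (S : set (nat * nat)) (x y : nat) :
  uniquely_represented S (x, y) <->
  exists a b c d : nat,
    [/\ S (a, b), S (c, d), a <> c \/ b <> d & a + c = x /\ b + d = y] /\
    forall a' b' c' d', S (a', b') -> S (c', d') -> a' <> c' \/ b' <> d' ->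
      a' + c' = x -> b' + d' = y ->
      a' = a /\ b' = b /\ c' = c /\ d' = d \/
      a' = c /\ b' = d /\ c' = a /\ d' = b.
Proof.
split.
  move=> [[a b] [[c d] [[Sab Scd ne [<- <-]] uniq]]].
  exists a, b, c, d; split; first split=> //.
    by case: (eqVneq a c) => [ac|/eqP]; [right=> bd; apply: ne; rewrite ac bd|left].
  move=> a' b' c' d' S1 S2 ne' e1 e2.
  have ne2 : (a', b') <> (c', d') by case=> ? ?; case: ne'.
  have [|[[-> ->] [-> ->]]|[[-> ->] [-> ->]]] := uniq _ _ S1 S2 ne2; [|by left|by right].
  by rewrite add_pairE e1 e2.
move=> [a [b [c [d [[Sab Scd ne [<- <-]] uniq]]]]].
exists (a, b), (c, d); split; first by split=> // -[? ?]; case: ne.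
move=> [a' b'] [c' d'] S1 S2 ne' [e1 e2].
have ne2 : a' <> c' \/ b' <> d'.
  by case: (eqVneq a' c') => [ac|/eqP]; [right=> bd; apply: ne'; rewrite ac bd|left].
by have [[-> [-> [-> ->]]]|[-> [-> [-> ->]]]] := uniq _ _ _ _ S1 S2 ne2 e1 e2; [left|right].
Qed.

Lemma uniquely_represented_sub (S T : set (nat * nat)) (x y w : nat * nat) :
  S `<=` T -> S x -> S y -> x <> y -> (x + y)%R = w ->
  (forall x' y', T x' -> T y' -> x' <> y' -> (x' + y')%R = w ->
     (x' = x /\ y' = y) \/ (x' = y /\ y' = x)) ->
  uniquely_represented S w.
Proof.
move=> ST Sx Sy xy xyw uniq; exists x, y; split=> // x' y' Sx' Sy'.
by apply: uniq; apply: ST.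
Qed.

Lemma uniquely_represented_neq0 (S : set (nat * nat)) w :
  uniquely_represented S w -> w <> (0, 0).
Proof.
case: w => x y /uniquely_representedP[a [b [c [d [[_ _ ne [ex ey]] _]]]]] [x0 y0].
lia.
Qed.

Lemma ulam_fixpoint_neq0 ws U : (0, 0) \notin ws -> ulam_fixpoint ws U ->
  ~ U (0, 0).
Proof.
move=> /negP ws0 fixU /fixU[//|/uniquely_represented_neq0]; exact.
Qed.

(** Induction on the coordinate sum: neither set contains (0, 0), so both summands of a point have a
    smaller coordinate sum, and the equation decides membership from points already settled. *)
Lemma ulam_fixpoint_sub ws U V : (0, 0) \notin ws ->
  ulam_fixpoint ws U -> ulam_fixpoint ws V -> U `<=` V.
Proof.
move=> ws0 fixU fixV.
suff H n w : w.1 + w.2 < n -> U w <-> V w by move=> w; apply: (H (w.1 + w.2).+1 w _).1.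
have U0 := ulam_fixpoint_neq0 ws0 fixU; have V0 := ulam_fixpoint_neq0 ws0 fixV.
elim: n w => [//|n IHn] [x y] /= xyn.
have half (S T : set (nat * nat)) : ~ S (0, 0) -> ~ T (0, 0) ->
    (forall z, z.1 + z.2 < n -> S z <-> T z) ->
    uniquely_represented S (x, y) -> uniquely_represented T (x, y).
  move=> S0 T0 ST /uniquely_representedP[a [b [c [d [[Sab Scd ne [ex ey]] uniq]]]]].
  have pos (Q : set (nat * nat)) p q : ~ Q (0, 0) -> Q (p, q) -> 0 < p + q.
    by case: p q => [|p] [|q].
  have ? := pos _ _ _ S0 Sab; have ? := pos _ _ _ S0 Scd.
  apply/uniquely_representedP; exists a, b, c, d; split.
    by split=> //; apply/ST => //=; lia.
  move=> a' b' c' d' Tab Tcd ne' ex' ey'.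
  have ? := pos _ _ _ T0 Tab; have ? := pos _ _ _ T0 Tcd.
  by apply: uniq => //; apply/ST => //=; lia.
rewrite (fixU (x, y)) (fixV (x, y)); split=> -[|ur]; [by left|right|by left|right].
  exact: half ur.
by apply: half ur => // z zn; rewrite IHn.
Qed.

Lemma ulam_fixpoint_unique ws U V : (0, 0) \notin ws ->
  ulam_fixpoint ws U -> ulam_fixpoint ws V -> U = V.
Proof.
move=> ws0 fU fV; apply/seteqP.
by split; [apply: ulam_fixpoint_sub fU fV|apply: ulam_fixpoint_sub fV fU].
Qed.

(** * Runs of the construction for a given norm *)

Section Runs.
Variables (R : realType) (N : int * int -> R).
Hypotheses (N_norm : is_norm N) (N_incr : increasing_in_each_coordinate N).
Local Notation nrm w := (N (Posz w.1, Posz w.2)).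

Lemma norm_lt_add (x y : nat * nat) : y <> (0, 0) -> (nrm x < nrm (x + y))%R.
Proof.
case: N_incr => incr1 incr2; case: x y => [a b] [c d] /= y0.
have [c0|c0] := posnP c; have [d0|d0] := posnP d.
- by case: y0; rewrite c0 d0.
- by rewrite c0 addr0; apply: incr2; rewrite -addn1 leq_add2l.
- by rewrite d0 addr0; apply: incr1; rewrite -addn1 leq_add2l.
apply: (@lt_trans _ _ (N (Posz (a + c), Posz b))).
  by apply: incr1; rewrite -addn1 leq_add2l.
by apply: incr2; rewrite -addn1 leq_add2l.
Qed.

Lemma norm_le_add (x y : nat * nat) : (nrm x <= nrm (x + y))%R.
Proof.
have [->|/eqP y0] := eqVneq y (0, 0); last exact/ltW/norm_lt_add.
by rewrite (_ : (0, 0) = 0%R) // addr0.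
Qed.

Lemma norm_pairMn (n : nat) (z : int * int) : N (z *+ n)%R = (n%:R * N z)%R.
Proof. by rewrite -(norm_homogeneous N_norm n z). Qed.

(** Dropping a coordinate does not increase the norm, so x N(1, 0) and y N(0, 1) are at most N(x,
    y), and the archimedean property bounds x and y. *)
Lemma bounded_of_norm_le (c : R) :
  exists M, forall w, (nrm w <= c)%R -> w.1 <= M /\ w.2 <= M.
Proof.
have pos z : z <> 0%R -> (0 < N z)%R.
  move=> z0; rewrite lt_neqAle norm_ge0 // andbT eq_sym.
  by apply/eqP => /(norm_eq0 N_norm).
pose e1 : int * int := (1%R, 0%R); pose e2 : int * int := (0%R, 1%R).
have e1_gt0 : (0 < N e1)%R by apply: pos.
have e2_gt0 : (0 < N e2)%R by apply: pos.
have bnd (e : int * int) (n : nat) : (0 < N e)%R -> (N (e *+ n) <= c)%R ->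
    n <= Num.bound (c / N e).
  move=> e0; rewrite norm_pairMn -ler_pdivlMr // => le.
  rewrite -(ler_nat R) ltW // (le_lt_trans le) // archi_boundP //.
  by rewrite (le_trans _ le) // ler0n.
exists (maxn (Num.bound (c / N e1)) (Num.bound (c / N e2))) => -[x y] /= le.
have x1 : (e1 *+ x)%R = (Posz x, 0%R).
  by elim: x {le} => // x IH; rewrite mulrS IH; congr pair; rewrite /= -PoszD.
have y1 : (e2 *+ y)%R = (0%R, Posz y).
  by elim: y {le} => // y IH; rewrite mulrS IH; congr pair; rewrite /= -PoszD.
split; rewrite leq_max.
  rewrite bnd // x1 (le_trans _ le) //.
  by have := norm_le_add (x, 0) (0, y); rewrite add_pairE addn0.
rewrite [X in _ || X]bnd ?orbT // y1 (le_trans _ le) //.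
by have := norm_le_add (0, y) (x, 0); rewrite add_pairE addn0.
Qed.

(** Only points of norm at most that of a given candidate compete for the minimum, and they lie in a
    finite box. *)
Lemma exists_ulam_step S : exists S', ulam_step N S S'.
Proof.
have [[w0 cw0]|none] := pselect (exists w, ulam_candidate S w); last first.
  by exists S; right; split=> // w cw; apply: none; exists w.
have [M bM] := bounded_of_norm_le (nrm w0).
pose pt (i : 'I_M.+1 * 'I_M.+1) : nat * nat := (val i.1, val i.2).
have inpt w : w.1 <= M /\ w.2 <= M -> exists i, pt i = w.
  case: w => x y /= [xM yM].
  by exists (inord x, inord y); rewrite /pt /= !inordK.
have [i0 i0w] := inpt _ (bM w0 (lexx _)).
have ci0 : `[< ulam_candidate S (pt i0) >] by apply/asboolP; rewrite i0w.
case: (@arg_minP _ _ _ i0 (fun i => `[< ulam_candidate S (pt i) >])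
  (fun i => nrm (pt i)) ci0) => i /asboolP ci imin.
exists (S `|` [set pt i]); left; exists (pt i); split=> // w cw.
have [le|lt] := leP (nrm w) (nrm w0).
  by have [j jw] := inpt _ (bM w le); rewrite -jw; apply: imin; apply/asboolP; rewrite jw.
by rewrite (le_trans _ (ltW lt)) // -i0w imin.
Qed.

Lemma exists_ulam_set ws : exists U, is_ulam_set N ws U.
Proof.
have [f fP] := choice exists_ulam_step.
pose stage n := iter n f [set w | w \in ws].
by exists (\bigcup_n stage n), stage; split=> // n; apply: fP.
Qed.

Section Run.
Variables (ws : seq (nat * nat)) (stage : nat -> set (nat * nat)).
Hypotheses (ws0 : (0, 0) \notin ws).
Hypotheses (stage0 : stage 0 = [set w | w \in ws]).
Hypotheses (stageS : forall n, ulam_step N (stage n) (stage n.+1)).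

Lemma stage_le m n : m <= n -> stage m `<=` stage n.
Proof.
elim: n => [|n IHn]; first by rewrite leqn0 => /eqP->.
rewrite leq_eqVlt => /orP[/eqP-> //|]; rewrite ltnS => /IHn mn x /mn xn.
by have [[w [_ _ ->]]|[_ ->]] := stageS n; first left.
Qed.

Lemma stage_neq0 n : ~ stage n (0, 0).
Proof.
elim: n => [|n IHn]; first by rewrite stage0 /=; apply/negP.
have [[w [[_ /uniquely_represented_neq0 w0] _ ->]]|[_ ->]] := stageS n => //.
by case=> [//|/esym].
Qed.

(** A candidate after one step either has the added point [u] as a summand, so that its norm is at
    least that of [u], or was a candidate before the step. *)
Lemma candidate_norm_ge n m (c : R) : n <= m ->
  (forall w, ulam_candidate (stage n) w -> (c <= nrm w)%R) ->
  forall w, ulam_candidate (stage m) w -> (c <= nrm w)%R.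
Proof.
elim: m => [|m IHm]; first by rewrite leqn0 => /eqP->.
rewrite leq_eqVlt => /orP[/eqP-> //|]; rewrite ltnS => nm cn w.
have {}IHm := IHm nm cn.
have := @stage_neq0 m.+1.
have [[u [cu _ ->]]|[_ ->]] := stageS m; last by move=> _; apply: IHm.
move=> n0 [nSw [x [y [[Sx Sy xy xyw] uniq]]]].
have cu_le := IHm _ cu.
have nz z : (stage m `|` [set u]) z -> z <> (0, 0) by move=> + z0; rewrite z0.
case: (Sx) => [mx|xu]; last first.
  by rewrite -xyw -xu in cu_le *; apply: le_trans cu_le (norm_le_add _ _).
case: (Sy) => [my|yu]; last first.
  by rewrite -xyw -yu addrC in cu_le *; apply: le_trans cu_le (norm_le_add _ _).
apply: IHm; split; first by move=> mw; apply: nSw; left.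
by apply: uniquely_represented_sub mx my xy xyw uniq; left.
Qed.

Lemma added_norm_ge n m (c : R) : n <= m ->
  (forall w, ulam_candidate (stage n) w -> (c <= nrm w)%R) ->
  forall w, stage m w -> ~ stage n w -> (c <= nrm w)%R.
Proof.
elim: m => [|m IHm]; first by rewrite leqn0 => /eqP-> _.
rewrite leq_eqVlt => /orP[/eqP-> //|]; rewrite ltnS => nm cn w.
have [[u [cu _ ->]]|[_ ->]] := stageS m; last exact: IHm.
by case=> [|-> _]; [apply: IHm|apply: candidate_norm_ge nm cn _ cu].
Qed.

Lemma stage_added m w : stage m w -> w \in ws \/
  exists n, ulam_candidate (stage n) w /\
    forall w', ulam_candidate (stage n) w' -> (nrm w <= nrm w')%R.
Proof.
elim: m => [|m IHm]; first by rewrite stage0; left.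
have [[u [cu umin ->]]|[_ ->]] := stageS m; last exact: IHm.
by case=> [/IHm //|->]; right; exists m.
Qed.

(* While w stays a candidate every step adds a point of norm at most [nrm w],
   and there are finitely many of those. *)
Lemma not_always_candidate n w :
  ~ (forall m, n <= m -> ulam_candidate (stage m) w).
Proof.
move=> cand; have [M bM] := bounded_of_norm_le (nrm w).
pose pt (i : 'I_M.+1 * 'I_M.+1) : nat * nat := (val i.1, val i.2).
pose A k : {set 'I_M.+1 * 'I_M.+1} := [set i | `[< stage (n + k) (pt i) >]]%SET.
have cardA k : k <= #|A k|.
  elim: k => [//|k IHk]; apply: leq_ltn_trans IHk _; apply: proper_card.
  have [[u [[nSu cu] umin stE]]|[none _]] := stageS (n + k); last first.
    by case: (none w); apply: cand; apply: leq_addr.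
  apply/properP; split.
    apply/fintype.subsetP => i; rewrite !inE => si.
    by apply: (stage_le _ si); rewrite addnS.
  have [u1 u2] := bM u (umin w (cand _ (leq_addr _ _))).
  have pu : pt (inord u.1, inord u.2) = u by rewrite /pt /= !inordK //; case: (u).
  exists (inord u.1, inord u.2); last by apply/negP; rewrite !inE pu.
  by rewrite !inE pu addnS stE; right.
have := leq_trans (cardA #|{: 'I_M.+1 * 'I_M.+1}|.+1) (max_card _).
by rewrite ltnn.
Qed.

(** If [w] is added to [stage n], later points have norm at least that of [w] while its summands
    have smaller norm, so every representation of [w] in the union already lies in [stage n].
    Conversely, a uniquely represented point that is never added would stay a candidate forever. *)
Lemma run_fixpoint : ulam_fixpoint ws (\bigcup_n stage n).
Proof.
move=> w; split.
  move=> [m _ /stage_added[|[n [[_ [x [y [[Sx Sy xy xyw] uniq]]]] wmin]]]]; [by left|].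
  right; exists x, y; split; first by split=> //; exists n.
  have early z z' : (\bigcup_n stage n) z -> (\bigcup_n stage n) z' ->
      (z + z')%R = w -> stage n z.
    move=> [k _ kz] [k' _ kz'] zw; apply: contrapT => nz.
    have kn := stage_le (leq_maxl k n) kz.
    have := added_norm_ge (leq_maxr k n) wmin kn nz; apply/negP; rewrite -ltNge -zw.
    by apply: norm_lt_add => z'0; apply: (@stage_neq0 k'); rewrite -z'0.
  move=> x' y' Ux' Uy' ne' e'; apply: uniq => //; first exact: early e'.
  by apply: early Uy' Ux' _; rewrite addrC.
move=> [wws|[x [y [[[k _ kx] [l _ ly] xy xyw] uniq]]]].
  by exists 0 => //; rewrite stage0.
apply: contrapT => nUw; apply: (@not_always_candidate (maxn k l) w) => m klm.
split; first by move=> mw; apply: nUw; exists m.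
have sub : stage m `<=` \bigcup_n stage n by move=> z mz; exists m.
apply: uniquely_represented_sub sub _ _ xy xyw uniq.
  by apply: (stage_le _ kx); apply: leq_trans klm; apply: leq_maxl.
by apply: (stage_le _ ly); apply: leq_trans klm; apply: leq_maxr.
Qed.

End Run.

(** For the converse, some run exists, its union solves the equation, and uniqueness identifies that
    union with [U]. *)
Lemma is_ulam_setP ws U : (0, 0) \notin ws ->
  is_ulam_set N ws U <-> ulam_fixpoint ws U.
Proof.
move=> ws0; split.
  by move=> [stage [stage0 stageS ->]]; apply: run_fixpoint.
move=> fixU; have [V ulamV] := exists_ulam_set ws.
have [stage [stage0 stageS VE]] := ulamV.
rewrite (ulam_fixpoint_unique ws0 fixU (_ : ulam_fixpoint ws V)) //.
by rewrite VE; apply: run_fixpoint.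
Qed.

End Runs.

(** * Sets made of two lines and interior points *)

Definition cross (I : nat -> nat -> Prop) : set (nat * nat) :=
  [set z | [\/ z.1 = 1, z.2 = 1 | I z.1 z.2]].

(** The clauses exclude in turn the sums (x-a, 1) + (a, y-1), (1, y-b) + (x-1, b) and those of two
    distinct interior points: all the rivals of (x-1, 1) + (1, y-1) when x, y >= 3. *)
Definition isolated (I : nat -> nat -> Prop) (x y : nat) : Prop :=
  [/\ forall a, a <= x -> ~ I a y.-1,
      forall b, b <= y -> ~ I x.-1 b
    & forall a b c d, I a b -> I c d -> a + c = x -> b + d = y ->
        a = c /\ b = d].

(** The equation is reduced to a condition on interior points. The generators in [V] are exempt from
    it, and only they may have a coordinate equal to 2. *)
Lemma cross_fixpoint (V : seq (nat * nat)) (I : nat -> nat -> Prop) :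
  (forall x y, (x, y) \in V -> [/\ 2 <= x, 2 <= y & I x y]) ->
  (forall x y, I x y -> (x, y) \in V \/ 3 <= x /\ 3 <= y) ->
  (forall x y, 3 <= x -> 3 <= y -> (x, y) \notin V -> I x y <-> isolated I x y) ->
  ulam_fixpoint [:: (1, 0), (0, 1) & V] (cross I).
Proof.
move=> VI IV Iiso.
have I2 x y : I x y -> 2 <= x /\ 2 <= y.
  by move=> /IV[/VI[]|] //; lia.
have crossE x y : cross I (x, y) -> x = 1 \/ y = 1 \/ 2 <= x /\ 2 <= y.
  by case=> [|| /I2] /=; lia.
move=> [x y]; rewrite !in_cons; split.
  have [xyV|xyV] := boolP ((x, y) \in V); first by move=> _; left; rewrite !orbT.
  move=> Cxy; have [/eqP[-> ->]|xy10] := boolP ((x, y) == (1, 0)); first by left.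
  have [/eqP[-> ->]|xy01] := boolP ((x, y) == (0, 1)); first by left.
  rewrite !xpair_eqE in xy10 xy01; right; apply/uniquely_representedP.
  have [x1|x1] := eqVneq x 1.
    exists 1, y.-1, 0, 1; split; first by split; [constructor 1|constructor 2|lia|lia].
    by move=> a b c d /crossE ? /crossE ? ? ? ?; lia.
  have [y1|y1] := eqVneq y 1.
    exists x.-1, 1, 1, 0; split; first by split; [constructor 2|constructor 1|lia|lia].
    by move=> a b c d /crossE ? /crossE ? ? ? ?; lia.
  case: Cxy => [/=|/=|/= Ixy]; try lia.
  have [|[x3 y3]] := IV _ _ Ixy; first by rewrite (negPf xyV).
  have [row col sum] := (Iiso _ _ x3 y3 xyV).1 Ixy.
  exists x.-1, 1, 1, y.-1; split; first by split; [constructor 2|constructor 1|lia|lia].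
  move=> a b c d.
  have rowN p q : I p q -> p <= x -> q <> y.-1.
    by move=> Ipq px qy; apply: (row p) => //; rewrite -qy.
  have colN p q : I p q -> q <= y -> p <> x.-1.
    by move=> Ipq qy px; apply: (col q) => //; rewrite -px.
  case=> [/= a1|/= b1|/= Iab]; case=> [/= c1|/= d1|/= Icd].
  1-2,4-5: lia.
  - by have := colN _ _ Icd; have := I2 _ _ Icd; lia.
  - by have := rowN _ _ Icd; have := I2 _ _ Icd; lia.
  - by have := colN _ _ Iab; have := I2 _ _ Iab; lia.
  - by have := rowN _ _ Iab; have := I2 _ _ Iab; lia.
  by move=> ne ex ey; have := sum _ _ _ _ Iab Icd ex ey; lia.
case.
  by case/or3P=> [/eqP[-> ->]|/eqP[-> ->]|/VI[]]; [constructor 1|constructor 2|constructor 3].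
move=> /uniquely_representedP[a [b [c [d [[Sab Scd ne [ex ey]] uniq]]]]].
have [x1|x1] := eqVneq x 1; first by constructor 1.
have [y1|y1] := eqVneq y 1; first by constructor 2.
have {}Sab := crossE _ _ Sab; have {}Scd := crossE _ _ Scd.
have C1 q : cross I (1, q) by constructor 1.
have D1 p : cross I (p, 1) by constructor 2.
(* On the axes the set contains only (0, 1) and (1, 0), and one of them would have to be used
   twice. *)
have [x0|x0] := posnP x; first lia.
have [y0|y0] := posnP y; first lia.
have u1 := uniq _ _ _ _ (D1 x.-1) (C1 y.-1).
(* For x = 2 the two rival sums are (1, 1) + (1, y-1) and (1, 0) + (1, y); at y = 2 the former
   repeats (1, 1), and (0, 1) + (2, 1) replaces it. *)
have [x2|x2] := eqVneq x 2.
  by have := uniq _ _ _ _ (C1 0) (C1 y); have := uniq _ _ _ _ (D1 0) (D1 x); lia.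
have [y2|y2] := eqVneq y 2.
  by have := uniq _ _ _ _ (D1 0) (D1 x); lia.
have [/VI[_ _ Ixy]|xyV] := boolP ((x, y) \in V); first by constructor 3.
have [x3 y3] : 3 <= x /\ 3 <= y by lia.
constructor 3 => /=; apply/Iiso => //; split.
- move=> p px Ip; have C : cross I (p, y.-1) by constructor 3.
  by have := uniq _ _ _ _ (D1 (x - p)) C; have := I2 _ _ Ip; lia.
- move=> q qy Iq; have C : cross I (x.-1, q) by constructor 3.
  by have := uniq _ _ _ _ (C1 (y - q)) C; have := I2 _ _ Iq; lia.
move=> p q r s Ipq Irs ep eq; have [? ?] := (I2 _ _ Ipq, I2 _ _ Irs).
have Cpq : cross I (p, q) by constructor 3.
have Crs : cross I (r, s) by constructor 3.
by have := uniq _ _ _ _ Cpq Crs; lia.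
Qed.

(** * The set A and the column-deleted, shifted and exceptional solutions *)

Definition odd_interior (x y : nat) : Prop := [/\ odd x, odd y, 3 <= x & 3 <= y].

(** Sums of two interior points have even coordinates, and a point with an even coordinate is
    blocked by (3, y-1) or (x-1, 3). *)
Lemma base_fixpoint : ulam_fixpoint [:: (1, 0); (0, 1)] (cross odd_interior).
Proof.
apply: cross_fixpoint => [//|x y [? ? ? ?]|x y x3 y3 _]; first by right.
split=> [[ox oy _ _]|[row col _]].
  by split=> [a ? []|b ? []|a b c d [? ? ? ?] [? ? ? ?]]; lia.
have ex : odd x.
  by apply/negPn/negP => nox; apply: (col 3) => //; split; lia.
by split=> //; apply/negPn/negP => noy; apply: (row 3) => //; split; lia.
Qed.

Definition with_point (v1 v2 : nat) (J : nat -> nat -> Prop) (x y : nat) : Prop :=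
  (x = v1 /\ y = v2) \/ J x y.

Lemma UA_fixpoint v1 v2 (J : nat -> nat -> Prop) : 2 <= v1 -> 2 <= v2 ->
  (forall x y, J x y -> 3 <= x /\ 3 <= y) ->
  (forall x y, 3 <= x -> 3 <= y -> x <> v1 \/ y <> v2 ->
     J x y <-> isolated (with_point v1 v2 J) x y) ->
  ulam_fixpoint (UA_generators v1 v2) (cross (with_point v1 v2 J)).
Proof.
move=> v1_ge2 v2_ge2 J3 Jiso; apply: cross_fixpoint => x y.
- by rewrite inE => /eqP[-> ->]; split=> //; left.
- by case=> [[-> ->]|/J3]; [left; rewrite inE|right].
move=> x3 y3; rewrite inE xpair_eqE => ne.
rewrite -Jiso //; last lia.
by split=> [[|//]|]; [lia|right].
Qed.

Definition column_deleted_interior (v1 v2 x y : nat) : Prop :=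
  odd_interior x y /\ (x = v1.+1 -> y < v2).

(** All interior ordinates are odd, which rules out sums of interior points at odd height. The new
    point blocks column v1+1 from height v2 on; as v2 >= 4, the point at height 3 of that column
    survives and still blocks column v1+2. *)
Lemma column_deleted_fixpoint v1 v2 : 2 <= v1 -> ~~ odd v1 -> odd v2 -> 4 <= v2 ->
  ulam_fixpoint (UA_generators v1 v2)
    (cross (with_point v1 v2 (column_deleted_interior v1 v2))).
Proof.
move=> v1_ge2 ev1 ov2 v2_ge4.
apply: UA_fixpoint => //; [lia|by move=> x y [[]]|move=> x y x3 y3 ne].
split=> [[[ox oy _ _] del]|[row col _]].
  split.
  - by move=> a ? [|[[]]]; lia.
  - by move=> b ? [|[[]]]; lia.
  by move=> a b c d [?|[[? ? ? ?] ?]] [?|[[? ? ? ?] ?]]; lia.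
have oy : odd y.
  apply/negPn/negP => noy.
  (* For v1 = 2 the deleted column is column 3, so (3, y-1) is missing once y > v2. Then (5, y-1)
     serves for x >= 5, (3, 3) blocks x = 4, and x = 3 is blocked by (2, v2) or, below v2, by (3,
     y-1). *)
  have [v1E|v1E] := eqVneq v1 2; last by apply: (row 3) => //; right; split; [split; lia|lia].
  have [x4|x4] := leqP 5 x; last first.
    have [x3'|x4'] : x = 3 \/ x = 4 by lia.
      have [yv|yv] := leqP v2 y; first by apply: (col v2) => //; left; lia.
      by apply: (row 3) => //; right; split; [split; lia|lia].
    by apply: (col 3) => //; right; split; [split; lia|lia].
  by apply: (row 5) => //; right; split; [split; lia|lia].
have ox : odd x.
  by apply/negPn/negP => nox; apply: (col 3) => //; right; split; [split; lia|lia].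
split=> // xv; rewrite ltnNge; apply/negP => yv.
by apply: (col v2) => //; left; lia.
Qed.

Definition shifted_interior (v1 x y : nat) : Prop :=
  [/\ 3 <= x, 3 <= y, odd y & x < v1 /\ odd x \/ v1 < x /\ ~~ odd x].

(** At height 3 the new point empties the interior of column v1+1 altogether, so column v1+2 is no
    longer blocked and the parity of the columns switches past v1. Ordinates stay odd, which again
    rules out sums of interior points. *)
Lemma shifted_fixpoint v1 : 2 <= v1 -> ~~ odd v1 ->
  ulam_fixpoint (UA_generators v1 3) (cross (with_point v1 3 (shifted_interior v1))).
Proof.
move=> v1_ge2 ev1.
apply: UA_fixpoint => //; [by move=> x y []|move=> x y x3 y3 ne].
split=> [[_ _ oy ox]|[row col _]].
  split.
  - by move=> a ? [|[]]; lia.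
  - by move=> b ? [|[]]; lia.
  by move=> a b c d [?|[? ? ? ?]] [?|[? ? ? ?]]; lia.
have oy : odd y.
  apply/negPn/negP => noy.
  (* For v1 = 2 there is no odd interior column: (4, y-1) takes over, and at x = 3 the generator (2,
     3) blocks. *)
  have [v1E|v1E] := eqVneq v1 2; last by apply: (row 3) => //; right; split; lia.
  have [x4|x4] := leqP 4 x; first by apply: (row 4) => //; right; split; lia.
  by apply: (col 3) => //; left; lia.
split=> //; have [xv|xv] := leqP x v1.
  left; have ox : odd x; last by lia.
  by apply/negPn/negP => nox; apply: (col 3) => //; right; split; lia.
right; split=> //; apply/negP => ox.
have [xv'|xv'] := eqVneq x v1.+1; first by apply: (col 3) => //; left; lia.
by apply: (col 3) => //; right; split; lia.
Qed.

Definition exceptional_interior (x y : nat) : Prop :=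
  [/\ 4 <= x, 4 <= y, ~~ odd x, ~~ odd y & [\/ x = 4, y = 4 | x = 8 /\ y = 8]].

(** Off row 4 and column 4, the even points with a coordinate 6 fall to (2, 2) + (4, y-2) or (2, 2)
    + (x-2, 4), and the others to (4, y-4) + (x-4, 4). Only (8, 8) escapes, since the last sum would
    take (4, 4) twice. *)
Lemma exceptional_fixpoint :
  ulam_fixpoint (UA_generators 2 2) (cross (with_point 2 2 exceptional_interior)).
Proof.
apply: UA_fixpoint => //; first by move=> x y []; lia.
move=> x y x3 y3 _; split.
  move=> [x4 y4 ex ey xy]; split.
  - by move=> a ? [|[]]; lia.
  - by move=> b ? [|[]]; lia.
  move=> a b c d.
  move=> [[-> ->]|[? ? ? ? ab]] [[-> ->]|[? ? ? ? cd]]; try lia.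
  - by case: xy => [||[]]; case: cd => [||[]]; lia.
  - by case: xy => [||[]]; case: ab => [||[]]; lia.
  by case: xy => [||[]]; case: ab => [||[]]; case: cd => [||[]]; lia.
move=> [row col sum].
have I4y q : 4 <= q -> ~~ odd q -> with_point 2 2 exceptional_interior 4 q.
  by right; split=> //; constructor 1.
have I4x p : 4 <= p -> ~~ odd p -> with_point 2 2 exceptional_interior p 4.
  by right; split=> //; constructor 2.
have I22 : with_point 2 2 exceptional_interior 2 2 by left.
have [x3'|x3'] := eqVneq x 3; first by case: (col 2); rewrite ?x3' //; lia.
have [y3'|y3'] := eqVneq y 3; first by case: (row 2); rewrite ?y3' //; lia.
have ey : ~~ odd y by apply/negP => oy; apply: (row 4); [lia|apply: I4y; lia].
have ex : ~~ odd x by apply/negP => ox; apply: (col 4); [lia|apply: I4x; lia].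
split=> //; try lia.
have [x4|x4] := eqVneq x 4; first by constructor 1.
have [y4|y4] := eqVneq y 4; first by constructor 2.
have [x6|x6] := eqVneq x 6.
  by have := sum 2 2 4 (y - 2) I22 (I4y _ _ _); lia.
have [y6|y6] := eqVneq y 6.
  by have := sum 2 2 (x - 2) 4 I22 (I4x _ _ _); lia.
by constructor 3; have := sum 4 (y - 4) (x - 4) 4 (I4y _ _ _) (I4x _ _ _); lia.
Qed.

(** * Solutions described by levels of translation *)

(* Translation by (p, q) raises the level by one, so the points of even level
   are exactly those that are not (p, q) plus a point of even level. *)
Definition level (p q x y : nat) : nat := minn (x %/ p) (y %/ q).

Lemma levelD p q x y : 0 < p -> 0 < q ->
  level p q (x + p) (y + q) = (level p q x y).+1.
Proof. by move=> p0 q0; rewrite /level !divnDr // !divnn p0 q0 !addn1 minnSS. Qed.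

Lemma level0 p q x y : x < p \/ y < q -> level p q x y = 0.
Proof.
by rewrite /level => -[/divn_small->|/divn_small->]; rewrite ?min0n ?minn0.
Qed.

(** The right-hand side describes the translate of [Wset p q] by k(p, q). *)
Lemma level_eqP p q x y k : 0 < p -> 0 < q ->
  level p q x y = k <->
  k * p <= x /\ k * q <= y /\ (x < k.+1 * p \/ y < k.+1 * q).
Proof.
move=> p0 q0; rewrite -!leq_divRL // -!ltn_divLR // /level; lia.
Qed.

Definition L_interior (v1 v2 x y : nat) : Prop :=
  odd_interior x y /\ ~~ odd (level v1 v2 x y).

(** By parity the only sum of interior points reaching an odd point is (v1, v2) + (x-v1, y-v2). So a
    point is present exactly when its translate back is absent, and presence alternates with the
    level. *)
Lemma L_fixpoint v1 v2 : 4 <= v1 -> ~~ odd v1 -> 4 <= v2 -> ~~ odd v2 ->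
  ulam_fixpoint (UA_generators v1 v2) (cross (with_point v1 v2 (L_interior v1 v2))).
Proof.
move=> v1_ge4 ev1 v2_ge4 ev2.
apply: UA_fixpoint; [lia|lia|by move=> x y [[]]|move=> x y x3 y3 ne].
have [v1_gt0 v2_gt0] : 0 < v1 /\ 0 < v2 by lia.
have lvl : v1 <= x -> v2 <= y -> level v1 v2 x y = (level v1 v2 (x - v1) (y - v2)).+1.
  by move=> vx vy; rewrite -levelD // !subnK.
split=> [[[ox oy _ _] lev]|[row col sum]].
  have far : v1 <= x -> v2 <= y -> odd (level v1 v2 (x - v1) (y - v2)).
    by move=> vx vy; move: lev; rewrite lvl //= negbK.
  split.
  (* If the generator lay in row y-1, the translate back would lie on y = 1, where the level is 0;
     likewise for column x-1. *)
  - by move=> a ax [[a1 y2]|[[]]]; last lia; have := far; rewrite level0; lia.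
  - by move=> b yb [[x1 b2]|[[]]]; last lia; have := far; rewrite level0; lia.
  move=> a b c d [[-> ->]|[[? ? ? ?] lab]] [[-> ->]|[[? ? ? ?] lcd]] ex ey; try lia.
  - have := far; rewrite -ex -ey !addKn; lia.
  - have := far; rewrite -ex -ey !addnK; lia.
have oy : odd y.
  apply/negPn/negP => noy; apply: (row 3) => //; right; split; first by split; lia.
  by rewrite level0 //; lia.
have ox : odd x.
  apply/negPn/negP => nox; apply: (col 3) => //; right; split; first by split; lia.
  by rewrite level0 //; lia.
split=> //; have [vx|vx] := leqP v1 x; last by rewrite level0 //; left.
have [vy|vy] := leqP v2 y; last by rewrite level0 //; right.
rewrite lvl //= negbK; apply/negPn/negP => lev.
(* A translate back on x = 1 or y = 1 is not interior; then (v1, v2) blocks through column x-1 or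
   row y-1 instead. *)
have [x1|x1] := eqVneq x v1.+1; first by apply: (col v2) => //; left; lia.
have [y1|y1] := eqVneq y v2.+1; first by apply: (row v1) => //; left; lia.
have Iv : with_point v1 v2 (L_interior v1 v2) v1 v2 by left.
have Iw : with_point v1 v2 (L_interior v1 v2) (x - v1) (y - v2).
  by right; split=> //; split; lia.
by have := sum _ _ _ _ Iv Iw; lia.
Qed.

(** Levels are counted from (v1+2, 5), the corner of the interior to the right of the generator. *)
Definition column_deleted_L_interior (v1 x y : nat) : Prop :=
  x < v1 /\ odd_interior x y \/
  [/\ v1 + 2 <= x, 5 <= y, ~~ odd x, odd y
    & ~~ odd (level v1 2 (x - (v1 + 2)) (y - 5))].

(** The generator blocks row 3 from abscissa v1 on and all of column v1+1, and column v1-1 blocks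
    column v1, so the interior resumes at (v1+2, 5), in even columns. There only sums with (v1, 2)
    have odd ordinate, and presence alternates with the level as in [L_fixpoint]. *)
Lemma column_deleted_L_fixpoint v1 : 4 <= v1 -> ~~ odd v1 ->
  ulam_fixpoint (UA_generators v1 2)
    (cross (with_point v1 2 (column_deleted_L_interior v1))).
Proof.
move=> v1_ge4 ev1; set I := with_point _ _ _.
apply: UA_fixpoint => //; first lia.
  by move=> x y [[_ []]|[]]; lia.
move=> x y x3 y3 ne; have v1_gt0 : 0 < v1 by lia.
have lvl : v1 + 2 + v1 <= x -> 7 <= y -> level v1 2 (x - (v1 + 2)) (y - 5) =
    (level v1 2 (x - v1 - (v1 + 2)) (y - 2 - 5)).+1.
  by move=> vx vy; rewrite -levelD //; congr level; lia.
have lvl0 p q : p < v1 + 2 + v1 \/ q < 7 -> ~~ odd (level v1 2 (p - (v1 + 2)) (q - 5)).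
  by move=> pq; rewrite level0 //; lia.
split.
  have far a b : v1 + 2 <= x -> ~~ odd x -> ~~ odd (level v1 2 (x - (v1 + 2)) (y - 5)) ->
      column_deleted_L_interior v1 a b -> v1 + a = x -> 2 + b = y -> False.
    move=> vx ex lev [[_ []]|[a4 b5 _ _ levab] xE yE]; first lia.
    by move: lev; rewrite lvl -?xE -?yE ?addKn ?[2 + b - 2]addKn /= ?negbK; lia.
  case=> [[xv [ox oy _ _]]|[xv y5 ex oy lev]].
    split.
    - by move=> a ax [|[[_ []]|[]]]; lia.
    - by move=> b bx [|[[? []]|[]]]; lia.
    by move=> a b c d [[? ?]|[[? [? ? ? ?]]|[? ? ? ? ?]]] [[? ?]|[[? [? ? ? ?]]|[? ? ? ? ?]]]; lia.
  split.
  - by move=> a ax [|[[_ []]|[]]]; lia.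
  - by move=> b bx [|[[? []]|[]]]; lia.
  move=> a b c d [[-> ->]|Jab] [[-> ->]|Jcd] ea eb; try lia.
  - by case: (far c d).
  - by case: (far a b) => //; lia.
  by case: Jab => [[_ []]|[]]; case: Jcd => [[_ []]|[]]; lia.
move=> [row col sum].
have I1 p q : p < v1 -> odd_interior p q -> I p q by right; left.
have oy : odd y.
  by apply/negPn/negP => noy; apply: (row 3) => //; apply: I1; [lia|split; lia].
have [xv|xv] := ltnP x v1.
  left; split=> //; split=> //; apply/negPn/negP => nox.
  by apply: (col 3) => //; apply: I1; [lia|split; lia].
have y5 : 5 <= y.
  by rewrite leqNgt; apply/negP => y5; apply: (row v1) => //; left; lia.
have xv0 : x <> v1.
  by move=> xv0; apply: (col 3) => //; apply: I1; [lia|split; lia].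
have xv1 : x <> v1.+1.
  by move=> xv1; apply: (col 2); [lia|left; lia].
have ex : ~~ odd x.
  by apply/negP => ox; apply: (col 5) => //; right; right; split; try lia; apply: lvl0; lia.
right; split=> //; try lia.
have [vx|vx] := leqP (v1 + 2 + v1) x; last by apply: lvl0; left.
have [vy|vy] := leqP 7 y; last by apply: lvl0; right.
rewrite lvl //= negbK; apply/negPn/negP => lev.
have Iw : I (x - v1) (y - 2) by right; right; split=> //; lia.
have Iv : I v1 2 by left.
by have := sum _ _ _ _ Iv Iw; lia.
Qed.

(** * Comparison with the sets named in the statement *)

Lemma in_Rset x y : Rset (x, y) <-> x = 1 \/ y = 1.
Proof.
split=> [[[m [_ ->]]|[m [-> _]]]|[->|->]]; [by right|by left| |].
  by right; exists y.
by left; exists x.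
Qed.

Lemma column_deleted_typeE v1 v2 : ~~ odd v1 ->
  column_deleted_type (cross (with_point v1 v2 (column_deleted_interior v1 v2))) v1 v2.
Proof.
move=> ev1; apply/seteqP; split=> -[x y].
  case=> /= [x1|y1|[[-> ->]|[[ox oy x3 y3] del]]]; [by left; right; apply/in_Rset; left
    |by left; right; apply/in_Rset; right|by left; left|right].
  by exists x./2, y./2; split; [lia|congr pair; lia].
case=> [[[-> ->]|/in_Rset[]]|[m [n [del [xE yE]]]]];
  [by constructor 3; left|by constructor 1|by constructor 2|].
have [x1|x1] := eqVneq x 1; first by constructor 1.
have [y1|y1] := eqVneq y 1; first by constructor 2.
by constructor 3; right; split; [split|]; rewrite /=; lia.
Qed.

Lemma shifted_column_deleted_typeE v1 : 2 <= v1 ->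
  shifted_column_deleted_type (cross (with_point v1 3 (shifted_interior v1))) v1 3.
Proof.
move=> v1_ge2; apply/seteqP; split=> -[x y].
  case=> /= [x1|y1|[[-> ->]|[x3 y3 oy [[xv ox]|[xv ex]]]]];
    [|by left; left; right; apply/in_Rset; right|by do 3!left|by left; right|by right].
  by left; left; right; apply/in_Rset; left.
case=> [[[[-> ->]|/in_Rset[]]|[/= xv ox oy]]|[/= xv ex oy]];
  [by constructor 3; left|by constructor 1|by constructor 2| |];
  have [x1|x1] := eqVneq x 1; try by constructor 1.
all: have [y1|y1] := eqVneq y 1; first by constructor 2.
  by constructor 3; right; split; rewrite /=; lia.
by constructor 3; right; split; rewrite /=; lia.
Qed.

Lemma exceptional_typeE :
  exceptional_type (cross (with_point 2 2 exceptional_interior)) 2 2.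
Proof.
apply/seteqP; split=> -[x y].
  case=> /= [x1|y1|[[-> ->]|[x4 y4 ex ey []]]].
  - by left; left; right; apply/in_Rset; left.
  - by left; left; right; apply/in_Rset; right.
  - by do 4!left.
  - by move=> xE; left; right; exists (y - 4)./2; congr pair; lia.
  - by move=> yE; right; exists (x - 4)./2; congr pair; lia.
  by move=> [-> ->]; do 3!left; right.
case=> [[[[[-> ->]|[-> ->]]|/in_Rset[]]|[m [-> ->]]]|[m [-> ->]]];
  [by constructor 3; left| |by constructor 1|by constructor 2| |];
  constructor 3; right; split; rewrite /=; try lia.
- by constructor 3.
- by constructor 1.
by constructor 2.
Qed.

Lemma L_typeE v1 v2 : 0 < v1 -> ~~ odd v1 -> 0 < v2 -> ~~ odd v2 ->
  L_type (cross (with_point v1 v2 (L_interior v1 v2))) v1 v2.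
Proof.
move=> v1_gt0 ev1 v2_gt0 ev2; apply/seteqP; split=> -[x y].
  case=> /= [x1|y1|[[-> ->]|[[ox oy x3 y3] lev]]]; [by left; right; apply/in_Rset; left
    |by left; right; apply/in_Rset; right|by left; left|right].
  have := (@level_eqP v1 v2 x y _ v1_gt0 v2_gt0).1 erefl.
  move: lev; set k := level _ _ _ _; rewrite !mulSn => ek [kx [ky kxy]].
  have [okx oky] : ~~ odd (k * v1) /\ ~~ odd (k * v2) by rewrite !oddM (negPf ek).
  (* Subtracting (v1, v2) as often as the level k allows leaves a point of [Wset v1 v2]; evenness of
     k gives m = k/2 and keeps the coordinates odd. *)
  exists (x - k * v1), (y - k * v2), k./2.
  have -> : 2 * k./2 = k by lia.
  by split; [lia|lia|rewrite /Wset /=; lia|congr pair; lia].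
case=> [[[-> ->]|/in_Rset[]]|[a [b [m [oa ob /= ab [-> ->]]]]]];
  [by constructor 3; left|by constructor 1|by constructor 2|].
have [x1|x1] := eqVneq (a + 2 * m * v1) 1; first by constructor 1.
have [y1|y1] := eqVneq (b + 2 * m * v2) 1; first by constructor 2.
have lev : level v1 v2 (a + 2 * m * v1) (b + 2 * m * v2) = 2 * m.
  by apply/level_eqP => //; rewrite !mulSn; move: ab; rewrite /Wset /=; lia.
have [o1 o2] : ~~ odd (2 * m * v1) /\ ~~ odd (2 * m * v2) by rewrite !oddM.
by constructor 3; right; split=> /=; [split; lia|rewrite lev; lia].
Qed.

Lemma column_deleted_L_typeE v1 : 2 <= v1 -> ~~ odd v1 ->
  column_deleted_L_type (cross (with_point v1 2 (column_deleted_L_interior v1))) v1 2.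
Proof.
move=> v1_ge2 ev1; have v1_gt0 : 0 < v1 by lia.
apply/seteqP; split=> -[x y].
  case=> /= [x1|y1|[[-> ->]|[[xv [ox oy _ _]]|[xv y5 ex oy lev]]]].
  - by left; left; right; apply/in_Rset; left.
  - by left; left; right; apply/in_Rset; right.
  - by do 3!left.
  - by left; right.
  have := (@level_eqP v1 2 (x - (v1 + 2)) (y - 5) _ v1_gt0 isT).1 erefl.
  right; move: lev H; set k := level _ _ _ _; rewrite !mulSn => ek [kx [ky kxy]].
  have ekv : ~~ odd (k * v1) by rewrite oddM (negPf ek).
  (* The level gives a < v1 or b < 2, and b is even, whence b = 0 in the second case. *)
  exists (x - (v1 + 2) - k * v1), (y - 5 - k * 2), k.
  by split; [lia|lia|lia|lia|rewrite mulnDl; congr pair; lia].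
case=> [[[[-> ->]|/in_Rset[]]|[/= xv ox oy]]|[a [b [m [ea eb em ab [-> ->]]]]]];
  [by constructor 3; left|by constructor 1|by constructor 2| |].
  have [x1|x1] := eqVneq x 1; first by constructor 1.
  have [y1|y1] := eqVneq y 1; first by constructor 2.
  by constructor 3; right; left; split=> //; split=> /=; lia.
have emv : ~~ odd (m * v1) by rewrite oddM (negPf em).
constructor 3; right; right; rewrite /= mulnDl.
have -> : a + (m * v1 + 1 * v1) + 2 - (v1 + 2) = a + m * v1 by lia.
have -> : b + 2 * m + 5 - 5 = b + 2 * m by lia.
have -> : level v1 2 (a + m * v1) (b + 2 * m) = m.
  by apply/level_eqP => //; rewrite !mulSn; lia.
by split; lia.
Qed.

(** * Classification and reflection *)

Lemma case_holds_inj U v1 v2 c c' :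
  case_holds U v1 v2 c -> case_holds U v1 v2 c' -> c = c'.
Proof. by case: c; case: c' => //= -[? ?] [? ?]; lia. Qed.

Lemma UA_generators_neq0 v1 v2 : v1 <> 0 -> (0, 0) \notin UA_generators v1 v2.
Proof. by move=> v10; rewrite !inE !xpair_eqE eq_sym /=; lia. Qed.

(** The disjunction leaves out v1 = 2 with v2 >= 4 even, the one family with v1 even that has to be
    reflected. *)
Lemma UA_classification U v1 v2 : 2 <= v1 -> 2 <= v2 -> ~~ odd v1 ->
  [\/ odd v2, v2 = 2 | 4 <= v1] -> ulam_fixpoint (UA_generators v1 v2) U ->
  exists! c, case_holds U v1 v2 c.
Proof.
move=> v1_ge2 v2_ge2 ev1 v12 fixU.
(* The parity and size conditions on v1 and v2 already exclude one another, so existence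
   suffices. *)
suff [c hc] : exists c, case_holds U v1 v2 c.
  by exists c; split=> // c' /(case_holds_inj hc).
have gens0 : (0, 0) \notin UA_generators v1 v2 by apply: UA_generators_neq0; lia.
have UE := ulam_fixpoint_unique gens0 fixU.
have [ov2|ev2] := boolP (odd v2).
  have [v23|v23] := eqVneq v2 3.
    exists CaseShiftedColumnDeleted; rewrite v23 in UE *; split=> //; split=> //.
    by rewrite (UE _ (shifted_fixpoint v1_ge2 ev1)); apply: shifted_column_deleted_typeE.
  have v2_ge4 : 4 <= v2 by lia.
  exists CaseColumnDeleted; do 2!split=> //.
  rewrite (UE _ (column_deleted_fixpoint v1_ge2 ev1 ov2 v2_ge4)).
  exact: column_deleted_typeE.
have [v22|v22] := eqVneq v2 2.
  rewrite v22 in UE *.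
  have [v12'|v12'] := eqVneq v1 2.
    exists CaseExceptional; rewrite v12' in UE *; split=> //.
    by rewrite (UE _ exceptional_fixpoint); apply: exceptional_typeE.
  have v1_ge4 : 4 <= v1 by lia.
  exists CaseColumnDeletedL; do 2!split=> //.
  by rewrite (UE _ (column_deleted_L_fixpoint v1_ge4 ev1)); apply: column_deleted_L_typeE.
have v1_ge4 : 4 <= v1 by case: v12; lia.
have v2_ge4 : 4 <= v2 by lia.
exists CaseL; do 2!split=> //.
by rewrite (UE _ (L_fixpoint v1_ge4 ev1 v2_ge4 ev2)); apply: L_typeE => //; lia.
Qed.

Lemma uniquely_represented_reflection U x y :
  uniquely_represented U (y, x) -> uniquely_represented (reflection U) (x, y).
Proof.
move=> /uniquely_representedP[a [b [c [d [[Sab Scd ne [ey ex]] uniq]]]]].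
apply/uniquely_representedP; exists b, a, d, c; split; first by split=> //; lia.
by move=> a' b' c' d' S1 S2 ne' ex' ey'; have := uniq b' a' d' c' S1 S2; lia.
Qed.

Lemma reflectionK U : reflection (reflection U) = U.
Proof. by apply/seteqP; split=> -[x y]. Qed.

Lemma reflection_fixpoint U v1 v2 :
  ulam_fixpoint (UA_generators v1 v2) U ->
  ulam_fixpoint (UA_generators v2 v1) (reflection U).
Proof.
move=> fixU [x y]; have UE : reflection U (x, y) <-> U (y, x) by [].
rewrite UE (fixU (y, x)) !inE !xpair_eqE.
split=> -[gen|ur]; [left; lia| |left; lia|].
  by right; apply: uniquely_represented_reflection.
by right; rewrite -[U]reflectionK; apply: uniquely_represented_reflection.
Qed.

Theorem theorem5p3 (R : realType) (N : int * int -> R)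
    (N_norm : is_norm N) (N_incr : increasing_in_each_coordinate N)
    (v1 v2 : nat) (v1_neq0 : v1 <> 0) (v2_neq0 : v2 <> 0)
    (U : set (nat * nat)) (U_ulam : is_ulam_set N (UA_generators v1 v2) U)
    (nondeg : ulam_nondegenerate N (UA_generators v1 v2)) :
  is_ulam_set N (UA_generators v2 v1) (reflection U) /\
  ((exists! c : ulam_case, case_holds U v1 v2 c) \/
   (exists! c : ulam_case, case_holds (reflection U) v2 v1 c)).
Proof.
have fixU : ulam_fixpoint (UA_generators v1 v2) U.
  by apply/(is_ulam_setP N_norm N_incr) => //; apply: UA_generators_neq0.
have fixU' := reflection_fixpoint fixU; split.
  by apply/(is_ulam_setP N_norm N_incr) => //; apply: UA_generators_neq0.
(* Dropping the third generator leaves A, so non-degeneracy puts (v1, v2) outside A: neither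
   coordinate is 1, and they are not both odd. *)
have notA : ~ cross odd_interior (v1, v2).
  apply: (nondeg 2) => //.
  by apply/(is_ulam_setP N_norm N_incr) => //; apply: base_fixpoint.
have v1_ge2 : 2 <= v1.
  by have [v11|] := eqVneq v1 1; [case: notA; constructor 1|lia].
have v2_ge2 : 2 <= v2.
  by have [v21|] := eqVneq v2 1; [case: notA; constructor 2|lia].
have not_odd : ~~ (odd v1 && odd v2).
  by apply/negP => /andP[o1 o2]; apply: notA; constructor 3; split=> //=; lia.
have [ok|nok] := boolP (~~ odd v1 && [|| odd v2, v2 == 2 | 4 <= v1]).
  left; apply: UA_classification => //; first by case/andP: ok.
  by case/andP: ok => _ /or3P[|/eqP|]; [constructor 1|constructor 2|constructor 3].
(* What remains is v1 odd, or v1 = 2 with v2 >= 4 even; in both cases v2 is even and the reflected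
   pair qualifies. *)
right; apply: UA_classification => //; first lia.
have [o1|e1] := boolP (odd v1); first by constructor 1.
have [v12|v12] := eqVneq v1 2; first by constructor 2.
by constructor 3; lia.
Qed.
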